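(* Let $(X,M,* )$ be any non-Archimedean fuzzy metric space with continuous $t$-norm defined by $a*b=\min\{a,b\}$ for all $a,b\in[0,1]$. Then $\operatorname{asdim}X=0$.
   Context: A continuous $t$-norm is a binary operation $*:[0,1]\times[0,1]\to[0,1]$ that is associative, commutative and continuous, satisfies $a*1=a$ for all $a\in[0,1]$, and satisfies $a*b\leq c*d$ whenever $a\leq c$ and $b\leq d$. A fuzzy metric space (in the sense of George and Veeramani) is a triple $(X,M,* )$ where $X$ is a set, $*$ is a continuous $t$-norm, and $M:X\times X\times(0,\infty)\to[0,1]$ satisfies for all $x,y,z\in X$ and all $s,t>0$: (1) $M(x,y,t)>0$; (2) $M(x,y,t)=1$ if and only if $x=y$; (3) $M(x,y,t)=M(y,x,t)$; (4) $M(x,y,t)*M(y,z,s)\leq M(x,z,t+s)$; (5) $M(x,y,\cdot)$ is continuous on $(0,\infty)$. It is non-Archimedean if $M(x,y,t)*M(y,z,t')\leq M(x,z,\max\{t,t'\})$ for all $x,y,z\in X$ and all $t,t'>0$; equivalently, $M(x,y,t)*M(y,z,t)\leq M(x,z,t)$ for all $x,y,z\in X$ and all $t>0$. A family $\mathcal{U}$ of subsets of $X$ is uniformly bounded if there exist $r\in(0,1)$ and $t>0$ such that $M(x,y,t)>1-r$ for all $x,y\in U$ and all $U\in\mathcal{U}$. Two subsets $U,U'$ are $(r,t)$-disjoint if $M(U,U',t)<1-r$, where $M(U,U',t)=\sup\{M(x,y,t)\mid x\in U,\,y\in U'\}$ (with $\sup\emptyset=0$); a family is $(r,t)$-disjoint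 if any two distinct elements of it are. For an integer $n\geq0$, $\operatorname{asdim}X\leq n$ means: for every $r\in(0,1)$ and $t>0$ there exist $(r,t)$-disjoint families $\mathcal{U}^0,\dots,\mathcal{U}^n$ of subsets of $X$ such that $\bigcup_i\mathcal{U}^i$ is a uniformly bounded cover of $X$. $\operatorname{asdim}X$ is the least such integer $n\geq0$, and $\infty$ if there is none. *)

(* Defs.v *)
From mathcomp Require Import all_boot all_order all_algebra.
From mathcomp Require Import all_classical all_reals all_analysis.
Set Implicit Arguments.
Unset Strict Implicit.
Unset Printing Implicit Defensive.
Import Order.TTheory GRing.Theory Num.Theory.
Import numFieldNormedType.Exports.
Local Open Scope classical_set_scope.
Local Open Scope ring_scope.

(* Operations on [0, 1] and functions of t > 0 are represented by total
   functions on R: every requirement is relativized to the domain, so their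
   values outside of it are irrelevant. *)

Record continuous_tnorm (R : realType) (op : R -> R -> R) : Prop :=
  ContinuousTNorm {
    tnorm_closed : forall a b : R, a \in `[0, 1] -> b \in `[0, 1] ->
      op a b \in `[0, 1] ;
    tnormA : forall a b c : R, a \in `[0, 1] -> b \in `[0, 1] -> c \in `[0, 1] ->
      op a (op b c) = op (op a b) c ;
    tnormC : forall a b : R, a \in `[0, 1] -> b \in `[0, 1] -> op a b = op b a ;
    tnorm_continuous : {within `[0, 1]%classic `*` `[0, 1]%classic,
      continuous (fun p : R * R => op p.1 p.2)} ;
    tnorm1 : forall a : R, a \in `[0, 1] -> op a 1 = a ;
    tnorm_le : forall a b c d : R, a \in `[0, 1] -> b \in `[0, 1] ->
      c \in `[0, 1] -> d \in `[0, 1] ->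
      a <= c -> b <= d -> op a b <= op c d }.

(* George-Veeramani fuzzy metric spaces *)
Record fuzzy_metric_space (R : realType) (X : Type) (M : X -> X -> R -> R)
    (op : R -> R -> R) : Prop :=
  FuzzyMetricSpace {
    fms_tnorm : continuous_tnorm op ;
    fms_itv : forall (x y : X) (t : R), 0 < t -> M x y t \in `[0, 1] ;
    fms_gt0 : forall (x y : X) (t : R), 0 < t -> 0 < M x y t ;
    fms_eq1 : forall (x y : X) (t : R), 0 < t -> (M x y t = 1 <-> x = y) ;
    fms_sym : forall (x y : X) (t : R), 0 < t -> M x y t = M y x t ;
    fms_triangle : forall (x y z : X) (t s : R), 0 < t -> 0 < s ->
      op (M x y t) (M y z s) <= M x z (t + s) ;
    fms_continuous : forall x y : X,
      {within `]0, +oo[%classic, continuous (M x y)} }.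

Definition non_archimedean (R : realType) (X : Type) (M : X -> X -> R -> R)
    (op : R -> R -> R) : Prop :=
  forall (x y z : X) (t t' : R), 0 < t -> 0 < t' ->
    op (M x y t) (M y z t') <= M x z (Num.max t t').

Definition uniformly_bounded (R : realType) (X : Type) (M : X -> X -> R -> R)
    (F : set (set X)) : Prop :=
  exists r t : R, [/\ 0 < r < 1, 0 < t &
    forall U, F U -> forall x y, U x -> U y -> 1 - r < M x y t].

(* The supremum is taken in R, where the library sets sup set0 = 0. *)
Definition set_proximity (R : realType) (X : Type) (M : X -> X -> R -> R)
    (U V : set X) (t : R) : R :=
  sup [set m | exists x y, [/\ U x, V y & m = M x y t]].

Definition disjoint_family (R : realType) (X : Type) (M : X -> X -> R -> R)
    (r t : R) (F : set (set X)) : Prop :=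
  forall U V, F U -> F V -> U <> V -> set_proximity M U V t < 1 - r.

Definition asdim_le (R : realType) (X : Type) (M : X -> X -> R -> R)
    (n : nat) : Prop :=
  forall r t : R, 0 < r < 1 -> 0 < t ->
    exists F : 'I_n.+1 -> set (set X),
      [/\ forall i, disjoint_family M r t (F i),
          \bigcup_(U in \bigcup_i F i) U = [set: X] &
          uniformly_bounded M (\bigcup_i F i)].

Definition asdim (R : realType) (X : Type) (M : X -> X -> R -> R) : \bar nat :=
  if pselect (exists n, `[< asdim_le M n >]) is left h
  then EFin (ex_minn h) else +oo%E.

(* Main.v *)
Require Import Defs.
From mathcomp Require Import all_boot all_order all_algebra.
From mathcomp Require Import all_classical all_reals all_analysis.
From mathcomp Require Import lra.
Import Order.TTheory GRing.Theory Num.Theory.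
Local Open Scope ring_scope.

(* With the minimum t-norm, [c < M x y t] is an equivalence relation in [x, y]
   for all [c < 1] and [t > 0].  Its classes cover [X], are uniformly bounded, and
   points of distinct classes satisfy [M x y t <= c]; so for [c < 1 - r] they
   form a single (r, t)-disjoint family. *)

Lemma asdim_eq0 (R : realType) (X : Type) (M : X -> X -> R -> R) :
  asdim_le M 0 -> asdim M = EFin 0%N.
Proof.
move=> M0; rewrite /asdim; case: pselect => [h|[]]; last first.
  by exists 0%N; exact/asboolP.
case: ex_minnP => n _ /(_ 0%N); rewrite leqn0 => n0.
by congr EFin; apply/eqP/n0/asboolP.
Qed.

Lemma set_proximity_le (R : realType) (X : Type) (M : X -> X -> R -> R)
    (U V : set X) (t c : R) : 0 <= c ->
  (forall x y, U x -> V y -> M x y t <= c) -> set_proximity M U V t <= c.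
Proof.
move=> c0 Mc; rewrite /set_proximity; set A := (A in sup A).
(* If [U] or [V] is empty, the supremum is the default value 0; this is where [0 <= c] enters. *)
have [->|A0] := eqVneq A set0; first by rewrite sup0.
apply: ge_sup; first exact/set0P.
by move=> _ [x [y [Ux Vy ->]]]; exact: Mc.
Qed.

Section min_tnorm.
Variables (R : realType) (X : Type) (M : X -> X -> R -> R) (op : R -> R -> R).
Hypothesis fms : fuzzy_metric_space M op.
Hypothesis nonarch : non_archimedean M op.
Hypothesis op_min : forall a b : R, a \in `[0, 1] -> b \in `[0, 1] ->
  op a b = Num.min a b.

Lemma min_tnorm_ultrametric (x y z : X) (t : R) : 0 < t ->
  Num.min (M x y t) (M y z t) <= M x z t.
Proof.
move=> t0; have := nonarch x y z t t t0 t0.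
by rewrite maxxx op_min ?(fms_itv fms).
Qed.

Lemma fuzzy_ball_trans (c t : R) (x y z : X) : 0 < t ->
  c < M x y t -> c < M y z t -> c < M x z t.
Proof.
move=> t0 cxy cyz; apply: lt_le_trans (min_tnorm_ultrametric x y z t t0).
by rewrite lt_min cxy.
Qed.

(** Each inclusion is one use of transitivity, the first after symmetry: as in an ultrametric space,
    every point of a ball is a centre of it. *)
Lemma fuzzy_ball_eq (c t : R) (x y : X) : 0 < t -> c < M x y t ->
  [set z | c < M x z t]%classic = [set z | c < M y z t]%classic.
Proof.
move=> t0 cxy; apply/seteqP; split=> z /=; apply: fuzzy_ball_trans => //.
by rewrite (fms_sym fms).
Qed.

Lemma asdim_le0_min_tnorm : asdim_le M 0.
Proof.
(* Halving puts [c] strictly between 0 and [1 - r]: a supremum of values at most [c] is only known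
   to be at most [c], yet must be strictly below [1 - r]. *)
move=> r t /andP[r0 r1] t0; pose c := (1 - r) / 2.
have Mxx x : M x x t = 1 by apply/(fms_eq1 fms).
pose B x := [set y | c < M x y t]%classic.
exists (fun=> range B); split=> [_|| ].
- move=> _ _ [x _ <-] [y _ <-] Bxy.
  suff: set_proximity M (B x) (B y) t <= c.
    by move/le_lt_trans; apply; rewrite /c; lra.
  apply: set_proximity_le => [|u v xu yv]; first by rewrite /c; lra.
  (* A pair with [c < M u v t] would give [B x = B u = B v = B y]. *)
  rewrite leNgt; apply/negP => uv; apply: Bxy.
  rewrite /B (fuzzy_ball_eq _ _ _ _ t0 xu) (fuzzy_ball_eq _ _ _ _ t0 uv).
  by rewrite (fuzzy_ball_eq _ _ _ _ t0 yv).
- apply/seteqP; split=> // x _; exists (B x).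
    by exists ord0 => //; exists x.
  by rewrite /B /= Mxx /c; lra.
(* The radius [1 - c] turns the bound into [c]; two points of [B x] are then compared through the
   centre [x]. *)
- exists (1 - c), t; split=> //; first by rewrite /c; lra.
  move=> _ [_ _ [x _ <-]] u v xu xv; rewrite subKr.
  by apply: fuzzy_ball_trans xv; rewrite // (fms_sym fms).
Qed.

End min_tnorm.

Theorem mainTheorem6 (R : realType) (X : Type) (M : X -> X -> R -> R)
    (op : R -> R -> R)
    (fms : fuzzy_metric_space M op)
    (nonarch : non_archimedean M op)
    (op_min : forall a b : R, a \in `[0, 1] -> b \in `[0, 1] ->
       op a b = Num.min a b) :
  asdim M = EFin 0%N.
Proof. exact/asdim_eq0/(asdim_le0_min_tnorm _ _ _ _ fms nonarch op_min). Qed.
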